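(* (Regional exponential growth.) Let $\zeta>0$ be any given constant, let $\phi^*:=\min_{\pi\in\Pi}\phi(\pi)$, and let $\Pi^*_{\ell_\pi}(\zeta):=\{\pi\in\Pi: \phi_{2\ell_\pi}(\pi)-\phi^*<\zeta\}$. Then for the $\ell_\pi$-weakly convex worst-case objective $\phi$ of the robust Markov decision process described in the context, $$\phi(\pi)-\phi^*\ \ge\ \zeta\,\exp\!\big(\mathrm{dist}(\pi,\Pi^*_{\ell_\pi}(\zeta))/C_{\ell_\pi}\big)\qquad\text{for all }\pi\in\Pi\setminus\Pi^*_{\ell_\pi}(\zeta),$$ where $C_{\ell_\pi}=\frac{D\sqrt{SA}}{1-\gamma}+\frac{L_\pi}{2\ell_\pi}$.
   Context: **RMDP.** States $\mathcal S=\{1,\dots,S\}$, actions $\mathcal A=\{1,\dots,A\}$, discount factor $\gamma\in(0,1)$, initial distribution $\rho\in\Delta^S$ ($\Delta^d$ is the probability simplex in $\mathbb R^d$), costs $c_{sas'}\in[0,1]$. A transition kernel is $p=(p_{sa})_{s,a}\in(\Delta^S)^{S\times A}$; policies form $\Pi=(\Delta^A)^S$. $v_s^{\pi,p}=\mathbb E_{\pi,p}[\sum_{t\ge0}\gamma^t c_{s_ta_ts_{t+1}}\mid s_0=s]$ and $J_\rho(\pi,p)=\sum_s\rho_s v_s^{\pi,p}$. The ambiguity set $\mathcal P\subseteq(\Delta^S)^{S\times A}$ is nonempty, compact, convex and $s$-rectangular: $\mathcal P=\mathcal P_1\times\cdots\times\mathcal P_S$, where $\mathcal P_s$ constrains $(p_{sa})_{a\in\mathcal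 A}$. Put $\phi(\pi):=\max_{p\in\mathcal P}J_\rho(\pi,p)$. **Constants.** $L_\pi:=\sqrt A/(1-\gamma)^2$, $\ell_\pi:=2\gamma A/(1-\gamma)^3$; $\phi$ is $L_\pi$-Lipschitz and $\ell_\pi$-weakly convex (i.e. $\phi+\frac{\ell_\pi}{2}\|\cdot\|^2$ is convex) on $\Pi$. $D:=\sup_{\pi\in\Pi,p\in\mathcal P}\|d_\rho^{\pi,p}/\rho\|_\infty$ is assumed finite, where $d_\rho^{\pi,p}(s')=(1-\gamma)\sum_s\sum_{t\ge0}\gamma^t\rho(s)p^\pi_{ss'}(t)$ and $p^\pi_{ss'}(t)$ is the probability of being in $s'$ after $t$ steps from $s$ under $(\pi,p)$. **Moreau envelope.** $\phi_{2\ell_\pi}(\pi):=\inf_{\pi'\in\Pi}\{\phi(\pi')+\ell_\pi\|\pi-\pi'\|^2\}$. $\|\cdot\|$ is the Euclidean/Frobenius norm and $\mathrm{dist}$ the associated distance to a set. **Known fact (from the literature) about this setting, available for use.** For every $\pi\in\Pi$, $\phi_{2\ell_\pi}(\pi)\le\phi(\pi)\le C_{\ell_\pi}\|\nabla\phi_{2\ell_\pi}(\pi)\|+\phi^*$. *)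

(* Defs.v *)
From HB Require Import structures.
From mathcomp Require Import all_boot all_order all_algebra.
From mathcomp Require Import all_classical all_reals all_analysis.

Set Implicit Arguments.
Unset Strict Implicit.
Unset Printing Implicit Defensive.

Import Order.TTheory GRing.Theory Num.Theory.
Import numFieldNormedType.Exports.

Local Open Scope classical_set_scope.
Local Open Scope ring_scope.

Definition simplex (R : realType) (d : nat) : set 'rV[R]_d :=
  [set v | (forall i, 0 <= v 0 i) /\ \sum_i v 0 i = 1].

(* The norm `|M| that MathComp-Analysis puts on matrices is the max norm, hence
   this separate Euclidean norm. Both induce the same topology. *)
Definition frob (R : realType) (m n : nat) (M : 'M[R]_(m, n)) : R :=
  Num.sqrt (\sum_i \sum_j M i j ^+ 2).

Definition fdist (R : realType) (m n : nat) (x : 'M[R]_(m, n))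
    (X : set 'M[R]_(m, n)) : R :=
  inf [set frob (x - y) | y in X].

Definition gradient (R : realType) (m n : nat) (f : 'M[R]_(m, n) -> R)
    (x : 'M[R]_(m, n)) : 'M[R]_(m, n) :=
  \matrix_(i, j) 'D_(delta_mx i j) f x.

(* An element [p] of [kernel R nS nA] is a matrix of row vectors: [p s a 0 s']
   is the probability of moving from [s] to [s'] under action [a]. Its topology
   is the entrywise one, i.e. that of R^(nS * nA * nS). *)
Notation kernel R nS nA := 'M['rV[R]_nS]_(nS, nA).

Definition kernels (R : realType) (nS nA : nat) : set (kernel R nS nA) :=
  [set p | forall s a, simplex (p s a)].

Definition policies (R : realType) (nS nA : nat) : set 'M[R]_(nS, nA) :=
  [set pi | forall s, simplex (row s pi)].
Arguments policies {R nS nA}.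

Definition kernel_convex (R : realType) (nS nA : nat)
    (P : set (kernel R nS nA)) : Prop :=
  forall p q (t : R), P p -> P q -> 0 <= t <= 1 ->
    P (\matrix_(s, a) (t *: p s a + (1 - t) *: q s a)).

Definition s_rectangular (R : realType) (nS nA : nat)
    (P : set (kernel R nS nA)) : Prop :=
  exists Ps : 'I_nS -> set 'rV['rV[R]_nS]_nA,
    P = [set p | forall s, Ps s (row s p)].

Record rmdp (R : realType) (nS nA : nat) := RMDP {
  discount : R;
  init : 'rV[R]_nS;
  cost : 'I_nS -> 'I_nA -> 'I_nS -> R;
  ambig : set (kernel R nS nA);
  actions_gt0 : (0 < nA)%N;
  discount_itv : 0 < discount < 1;
  init_simplex : simplex init;
  cost_itv : forall s a s', 0 <= cost s a s' <= 1;
  ambig_kernels : ambig `<=` @kernels R nS nA;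
  ambig_neq0 : ambig !=set0;
  ambig_compact : compact ambig;
  ambig_convex : kernel_convex ambig;
  ambig_rectangular : s_rectangular ambig }.

Section Trajectories.
Context {R : realType} {nS nA : nat}.
Implicit Types (pi : 'M[R]_(nS, nA)) (p : kernel R nS nA) (s : 'I_nS).

(* A trajectory of horizon [T] is the sequence of states x_0, ..., x_T together
   with the sequence of actions a_0, ..., a_(T-1). The states before and after
   step [t] are x_t and x_(t+1). *)
Definition src T (x : {ffun 'I_T.+1 -> 'I_nS}) (t : 'I_T) : 'I_nS :=
  x (widen_ord (leqnSn T) t).
Definition tgt T (x : {ffun 'I_T.+1 -> 'I_nS}) (t : 'I_T) : 'I_nS :=
  x (lift ord0 t).

Definition traj_prob pi p s T
    (x : {ffun 'I_T.+1 -> 'I_nS}) (a : {ffun 'I_T -> 'I_nA}) : R :=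
  (x ord0 == s)%:R *
  \prod_(t < T) (pi (src x t) (a t) * p (src x t) (a t) 0 (tgt x t)).

Definition traj_expect pi p s T
    (f : {ffun 'I_T.+1 -> 'I_nS} -> {ffun 'I_T -> 'I_nA} -> R) : R :=
  \sum_x \sum_a traj_prob pi p s x a * f x a.

Definition visit_prob pi p s s' (t : nat) : R :=
  traj_expect pi p s (T := t) (fun x _ => (x ord_max == s')%:R).

End Trajectories.

Section RobustMDP.
Context {R : realType} {nS nA : nat}.
Variable M : rmdp R nS nA.
Implicit Types (pi : 'M[R]_(nS, nA)) (p : kernel R nS nA) (s : 'I_nS).

Let gamma := discount M.
Let rho s : R := init M 0 s.

(* E[\sum_(t >= 0) gamma^t c_t | s_0 = s], as the limit of the expected
   discounted costs over finite horizons. *)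
Definition value pi p s : R :=
  limn (fun T => traj_expect pi p s (T := T) (fun x a =>
    \sum_(t < T) gamma ^+ t * cost M (src x t) (a t) (tgt x t))).

Definition J pi p : R := \sum_s rho s * value pi p s.

Definition phi pi : R := sup [set J pi p | p in ambig M].

Definition phi_min : R := inf [set phi pi | pi in policies].

Definition L_pi : R := Num.sqrt nA%:R / (1 - gamma) ^+ 2.
Definition ell_pi : R := 2 * gamma * nA%:R / (1 - gamma) ^+ 3.

Definition occupancy pi p s' : R :=
  (1 - gamma) * \sum_s
    limn (series (fun t => gamma ^+ t * rho s * visit_prob pi p s s' t)).

(* The quotients are extended reals: x / 0 = +oo for x > 0, and 0 / 0 = 0. *)
Definition mismatch pi p : \bar R :=
  \big[maxe/0%E]_(s < nS) (`|(occupancy pi p s)%:E / (rho s)%:E|)%E.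

Definition D_mismatch : \bar R :=
  ereal_sup [set mismatch pi p | pi in policies & p in ambig M].

Definition C_ell : R :=
  fine D_mismatch * Num.sqrt (nS%:R * nA%:R) / (1 - gamma)
  + L_pi / (2 * ell_pi).

(* phi_(2 ell_pi), defined on the whole matrix space so that it has a gradient
   at every policy. *)
Definition moreau pi : R :=
  inf [set phi pi' + ell_pi * frob (pi - pi') ^+ 2 | pi' in policies].

Definition near_opt (zeta : R) : set 'M[R]_(nS, nA) :=
  [set pi | policies pi /\ moreau pi - phi_min < zeta].

End RobustMDP.

(* Main.v *)
Require Import Defs.
From HB Require Import structures.
From mathcomp Require Import all_boot all_order all_algebra.
From mathcomp Require Import all_classical all_reals all_analysis.
From mathcomp Require Import ring lra.

(* The envelope E is an infimum of quadratics: at each policy a there is a policy q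
   such that E lies below E(a) + l (|x - q|^2 - |a - q|^2), with equality at a.
   Hence every existing partial derivative of E at a is that of this quadratic, so
   that |grad E(a)| <= 2 l |a - q|, and moving from a towards q, which stays
   within the convex set of policies, decreases E at rate at least |grad E(a)|.
   With the known fact E - phi_min <= C |grad E|, the function log (E - phi_min) has
   slope at least 1/C on the policies off the sublevel set, and Ekeland's
   variational argument bounds it below by log zeta + dist / C. *)

Set Implicit Arguments.
Unset Strict Implicit.
Unset Printing Implicit Defensive.

Import Order.TTheory GRing.Theory Num.Theory.
Import numFieldNormedType.Exports.

Local Open Scope classical_set_scope.
Local Open Scope ring_scope.

(** * Euclidean norm and distance on matrices *)

Section Frobenius.
Context {R : realType} {m n : nat}.
Implicit Types x y : 'M[R]_(m, n).

Lemma frob_ge0 x : 0 <= frob x.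
Proof. exact: sqrtr_ge0. Qed.

Lemma sqr_frob x : frob x ^+ 2 = \sum_i \sum_j x i j ^+ 2.
Proof.
by rewrite sqr_sqrtr// sumr_ge0// => i _; rewrite sumr_ge0// => j _; exact: sqr_ge0.
Qed.

Lemma frob_le x y : (forall i j, `|x i j| <= `|y i j|) -> frob x <= frob y.
Proof.
move=> xy; rewrite -(ler_pXn2r (ltn0Sn 1)) ?nnegrE ?frob_ge0// !sqr_frob.
apply: ler_sum => i _; apply: ler_sum => j _.
by rewrite -(real_normK (num_real (x i j))) -(real_normK (num_real (y i j)))
  lerXn2r ?nnegrE.
Qed.

Lemma frob_eq0 x : frob x = 0 -> x = 0.
Proof.
move=> x0; have := sqr_frob x; rewrite x0 expr0n/= => /esym/eqP.
rewrite psumr_eq0 => [/allP s0|i _]; last by rewrite sumr_ge0// => j _; exact: sqr_ge0.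
apply/matrixP => i j; have := s0 i (mem_index_enum _).
rewrite psumr_eq0 => [/allP /(_ j (mem_index_enum _))|k _]; last exact: sqr_ge0.
by rewrite sqrf_eq0 mxE => /eqP.
Qed.

Lemma frobZ (t : R) x : frob (t *: x) = `|t| * frob x.
Proof.
rewrite -sqrtr_sqr -sqrtrM ?sqr_ge0//; congr Num.sqrt.
rewrite mulr_sumr; apply: eq_bigr => i _; rewrite mulr_sumr.
by apply: eq_bigr => j _; rewrite mxE exprMn.
Qed.

Lemma frob_distC x y : frob (x - y) = frob (y - x).
Proof. by rewrite -opprB -scaleN1r frobZ normrN1 mul1r. Qed.

(** Expanding the nonnegative square of [frob (frob y *: x - frob x *: y)] leaves the difference of
    the two sides times [2 * (frob x * frob y)]. *)
Lemma frob_CauchySchwarz x y : \sum_i \sum_j x i j * y i j <= frob x * frob y.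
Proof.
have [x0|xn0] := eqVneq (frob x) 0.
  rewrite x0 mul0r (frob_eq0 x0) big1// => i _.
  by rewrite big1// => j _; rewrite mxE mul0r.
have [y0|yn0] := eqVneq (frob y) 0.
  rewrite y0 mulr0 (frob_eq0 y0) big1// => i _.
  by rewrite big1// => j _; rewrite mxE mulr0.
have x_gt0 : 0 < frob x by rewrite lt_def xn0 frob_ge0.
have y_gt0 : 0 < frob y by rewrite lt_def yn0 frob_ge0.
have : 0 <= frob (frob y *: x - frob x *: y) ^+ 2 by exact: sqr_ge0.
have -> : frob (frob y *: x - frob x *: y) ^+ 2 =
    2 * (frob x * frob y) * (frob x * frob y - \sum_i \sum_j x i j * y i j).
  rewrite sqr_frob mulrBr.
  transitivity (frob y ^+ 2 * (frob x ^+ 2) + frob x ^+ 2 * (frob y ^+ 2) -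
      2 * (frob x * frob y) * \sum_i \sum_j x i j * y i j); last by ring.
  rewrite [in frob y ^+ 2 * _](sqr_frob x) [in frob x ^+ 2 * _](sqr_frob y).
  rewrite !mulr_sumr -big_split -sumrB/=; apply: eq_bigr => i _.
  rewrite !mulr_sumr -big_split -sumrB/=; apply: eq_bigr => j _.
  by rewrite !mxE; ring.
by rewrite pmulr_rge0 ?subr_ge0// !mulr_gt0.
Qed.

Lemma frob_triangle x y : frob (x + y) <= frob x + frob y.
Proof.
rewrite -(ler_pXn2r (ltn0Sn 1)) ?nnegrE ?addr_ge0 ?frob_ge0//.
have -> : frob (x + y) ^+ 2 =
    frob x ^+ 2 + frob y ^+ 2 + 2 * \sum_i \sum_j x i j * y i j.
  rewrite !sqr_frob mulr_sumr -!big_split/=; apply: eq_bigr => i _.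
  rewrite mulr_sumr -!big_split/=; apply: eq_bigr => j _.
  by rewrite mxE; ring.
have := frob_CauchySchwarz x y; nra.
Qed.

Lemma continuous_coord_sum (T : topologicalType) (F : 'I_m -> 'I_n -> T -> R) :
  (forall i j, continuous (F i j)) ->
  continuous (fun t => \sum_i \sum_j F i j t).
Proof.
move=> cF; apply: continuous_big => [|i _]; first exact: add_continuous.
by apply: continuous_big => [|j _]; [exact: add_continuous|exact: cF].
Qed.

Lemma frob_continuous : continuous (@frob R m n).
Proof.
move=> x; apply: (@continuous_comp _ _ _
  (fun x : 'M[R]_(m, n) => \sum_i \sum_j x i j ^+ 2) Num.sqrt);
  last exact: sqrt_continuous.
apply: continuous_coord_sum => i j y; apply: continuousM; exact: coord_continuous.
Qed.

Lemma fdist_le x y (X : set 'M[R]_(m, n)) : X y -> fdist x X <= frob (x - y).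
Proof.
move=> Xy; apply: ge_inf; last by exists y.
by exists 0 => _ [z _ <-]; exact: frob_ge0.
Qed.

End Frobenius.

(** The near-minimizers of [f] on [A] generate a proper filter, and compactness gives it a cluster
    point [q]. *)
Lemma compact_near_minimizer {R : realType} (T : topologicalType) (A : set T)
    (f : T -> R) :
  A !=set0 -> compact A -> has_lbound [set f x | x in A] ->
  exists2 q, A q & forall U (e : R), nbhs q U -> 0 < e ->
    exists x, [/\ A x, U x & f x < inf [set f x | x in A] + e].
Proof.
move=> A0 cA fA; set mf := inf _.
pose B (e : R) := [set x | A x /\ f x < mf + e].
have FF : ProperFilter (filter_from [set e : R | 0 < e] B).
  apply: filter_from_proper.
    apply: filter_from_filter; first by exists 1 => /=.
    move=> e1 e2 /= e10 e20; exists (Num.min e1 e2); first by rewrite /= lt_min e10.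
    by move=> x [Ax]; rewrite -ltrBlDl lt_min !ltrBlDl => /andP[].
  move=> e /= e0; have [|_ [x Ax <-] fx] := inf_adherent (E := f @` A) e0.
    by split=> //; have [x Ax] := A0; exists (f x), x.
  by exists x.
have [|q [Aq Fq]] := cA _ FF; first by exists 1 => //= x [].
exists q => // U e qU e0; have [|x [[Ax fx] Ux]] := Fq (B e) U _ qU.
  by exists e.
by exists x.
Qed.

(* [g] need not be differentiable: where a partial derivative does not exist, the
   corresponding entry of [gradient g a] is [0]. *)
Lemma gradient_coord_le {R : realType} {m n : nat} (g : 'M[R]_(m, n) -> R)
    (a q : 'M[R]_(m, n)) (l : R) :
  (forall x, g x <= g a + l * (frob (x - q) ^+ 2 - frob (a - q) ^+ 2)) ->
  forall i j, `|gradient g a i j| <= `|((2 * l) *: (a - q)) i j|.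
Proof.
move=> maj i j; rewrite /gradient !mxE.
have [dg|/dvgP ndg] := pselect (derivable g a (delta_mx i j)); last first.
  by rewrite /derive ndg normr0.
set s := a i j - q i j.
pose Q (h : R) := h^-1 *: ((g \o shift a) (h *: delta_mx i j) - g a).
(* Only the entry [(i, j)] moves, so the difference of squared norms reduces to
   [h * (2 * s + h)]. *)
have incr h : (g \o shift a) (h *: delta_mx i j) - g a <= h * (l * (2 * s + h)).
  rewrite lerBlDl; apply: le_trans (maj _) _; rewrite lerD2l.
  suff -> : frob (h *: delta_mx i j + a - q) ^+ 2 - frob (a - q) ^+ 2 =
      h * (2 * s + h) by rewrite mulrCA.
  rewrite !sqr_frob -sumrB (bigD1 i)//= [X in _ + X]big1 ?addr0 => [|k ki]; last first.
    rewrite -sumrB big1// => k' _.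
    by rewrite !mxE (negbTE ki)/= mulr0 add0r subrr.
  rewrite -sumrB (bigD1 j)//= [X in _ + X]big1 ?addr0 => [|k kj]; last first.
    by rewrite !mxE (negbTE kj) andbF mulr0 add0r subrr.
  by rewrite !mxE !eqxx/= /s; ring.
have bnd_cvg : (fun h : R => l * (2 * s + h)) h @[h --> (0 : R)] --> l * (2 * s).
  rewrite -[in X in _ --> X](addr0 (2 * s)).
  apply: (@cvgM _ _ (nbhs (0 : R))); first exact: cvg_cst.
  by apply: (@cvgD _ _ _ (nbhs (0 : R))); [exact: cvg_cst|exact: cvg_id].
(* Dividing [incr] by [h] bounds the quotient above for [h > 0] and below for [h < 0]; both bounds
   have the same limit, which must be the derivative. *)
suff -> : 'D_(delta_mx i j) g a = 2 * l * s by [].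
apply/eqP; rewrite eq_le -mulrA mulrCA; apply/andP; split.
- apply: (@ler_cvg_to _ _ _ _ Q (fun h => l * (2 * s + h)) _ _
    (cvg_dnbhs_at_right dg) (cvg_at_right_filter bnd_cvg)).
  near=> h; have h0 : 0 < h by near: h; exact: nbhs_right_gt.
  by rewrite /Q /GRing.scale/= [leLHS]mulrC ler_pdivrMr// [leRHS]mulrC; exact: incr.
- apply: (@ler_cvg_to _ _ _ _ (fun h => l * (2 * s + h)) Q _ _
    (cvg_at_left_filter bnd_cvg) (cvg_dnbhs_at_left dg)).
  near=> h; have h0 : h < 0 by near: h; exact: nbhs_left_lt.
  by rewrite /Q /GRing.scale/= [leRHS]mulrC ler_ndivlMr// [leRHS]mulrC; exact: incr.
Unshelve. all: by end_near. Qed.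

(** * The Moreau envelope over a compact set of matrices *)

Section Envelope.
Context {R : realType} {m n : nat}.
Variables (l : R) (f : 'M[R]_(m, n) -> R) (A : set 'M[R]_(m, n)).
Hypotheses (l_gt0 : 0 < l) (f_ge0 : forall y, A y -> 0 <= f y).
Hypotheses (A_neq0 : A !=set0) (A_compact : compact A).
Hypothesis A_le1 : forall y i j, A y -> `|y i j| <= 1.

(** For [l := ell_pi M], [f := phi M] and [A := policies] this is [moreau M] by conversion. *)
Definition envelope x : R := inf [set f y + l * frob (x - y) ^+ 2 | y in A].

Lemma envelope_objective_ge0 x y : A y -> 0 <= f y + l * frob (x - y) ^+ 2.
Proof. by move=> Ay; rewrite addr_ge0 ?f_ge0// mulr_ge0 ?sqr_ge0// ltW. Qed.

Lemma envelope_le x y : A y -> envelope x <= f y + l * frob (x - y) ^+ 2.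
Proof.
move=> Ay; apply: ge_inf; last by exists y.
by exists 0 => _ [z Az <-]; exact: envelope_objective_ge0.
Qed.

(* [f] need not be lower semicontinuous: [q] is a cluster point of near-minimizers
   of the infimum defining [envelope a], not necessarily a minimizer. *)
Lemma envelope_majorant a : exists2 q, A q & forall x,
  envelope x <= envelope a + l * (frob (x - q) ^+ 2 - frob (a - q) ^+ 2).
Proof.
have [|q Aq near_q] := @compact_near_minimizer R _ A
    (fun y => f y + l * frob (a - y) ^+ 2) A_neq0 A_compact.
  by exists 0 => _ [z Az <-]; exact: envelope_objective_ge0.
exists q => // x; apply/ler_addgt0Pr => e e0.
(* The objectives at [x] and at [a] differ by [h], in which [f] cancels; continuity of [h] then
   suffices to pass from near-minimizers to [q]. *)
pose h y := l * (frob (x - y) ^+ 2 - frob (a - y) ^+ 2).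
have h_cont : continuous h.
  have c z : continuous (fun y : 'M[R]_(m, n) => frob (z - y) ^+ 2).
    move=> y; have cy : frob (z - t) @[t --> y] --> frob (z - y).
      apply: (@cvg_comp _ _ _ (fun t => z - t) (@frob R m n) _ _ _ _
        (@frob_continuous _ _ _ (z - y))).
      by apply: (@cvgB _ _ _ (nbhs y)); [exact: cvg_cst|exact: cvg_id].
    rewrite /continuous_at expr2; under eq_cvg do rewrite expr2.
    exact: (cvgM cy cy).
  move=> y; apply: (@cvgM _ _ (nbhs y)); first exact: cvg_cst.
  by apply: (@cvgB _ _ _ (nbhs y)); exact: c.
have e20 : 0 < e / 2 by rewrite divr_gt0.
have hU : nbhs q [set y | h y < h q + e / 2].
  by apply: cvgr_lt (h_cont q) _ _; rewrite ltrDl.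
have [y [Ay /= hy]] := near_q _ _ hU e20.
rewrite -/(envelope a) => gy; have := envelope_le x Ay.
rewrite /h in hy; lra.
Qed.

(** Factoring the differences of squares in [envelope_majorant] leaves [q] only in a term bounded
    through [A_le1], whence the [2]. The bound is symmetric in [x] and [a], so it yields continuity
    by squeezing. *)
Lemma envelope_dist x a : envelope x - envelope a <=
  l * \sum_i \sum_j `|x i j - a i j| * (`|x i j| + `|a i j| + 2).
Proof.
have [q Aq /(_ x) xa] := envelope_majorant a.
rewrite lerBlDl; apply: le_trans xa _; rewrite lerD2l ler_pM2l// !sqr_frob -sumrB.
apply: ler_sum => i _; rewrite -sumrB; apply: ler_sum => j _; rewrite !mxE.
have -> : (x i j - q i j) ^+ 2 - (a i j - q i j) ^+ 2 =
  (x i j - a i j) * (x i j + a i j - q i j *+ 2) by ring.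
apply: le_trans (ler_norm _) _; rewrite normrM ler_wpM2l//.
apply: le_trans (ler_normB _ _) _; apply: lerD; first exact: ler_normD.
by rewrite normrMn ler_pMn2r// A_le1.
Qed.

Lemma envelope_continuous : continuous envelope.
Proof.
move=> a.
pose d (x : 'M[R]_(m, n)) :=
  l * \sum_i \sum_j `|x i j - a i j| * (`|x i j| + `|a i j| + 2).
have d_cont : continuous d.
  have S_cont : continuous (fun x : 'M[R]_(m, n) =>
      \sum_i \sum_j `|x i j - a i j| * (`|x i j| + `|a i j| + 2)).
    apply: continuous_coord_sum => i j y.
    have cy : (fun z : 'M[R]_(m, n) => z i j) z @[z --> y] --> y i j
      by exact: coord_continuous.
    apply: (@cvgM _ _ (nbhs y)).
      by apply: cvg_norm; apply: (@cvgB _ _ _ (nbhs y)) => //; exact: cvg_cst.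
    apply: (@cvgD _ _ _ (nbhs y)); last exact: cvg_cst.
    by apply: (@cvgD _ _ _ (nbhs y)); [exact: cvg_norm|exact: cvg_cst].
  by move=> x; apply: (@cvgM _ _ (nbhs x)); [exact: cvg_cst|exact: S_cont].
have d0 : d a = 0.
  rewrite /d big1 ?mulr0// => i _; rewrite big1// => j _.
  by rewrite subrr normr0 mul0r.
have da : d x @[x --> a] --> 0 by rewrite -d0; exact: d_cont.
apply: (@squeeze_cvgr _ (nbhs a) _ _
  (fun x => envelope a - d x) (fun x => envelope a + d x)).
- apply: nearW => x; rewrite lerBlDr -lerBlDl -lerBlDl.
  rewrite envelope_dist andbT; apply: le_trans (envelope_dist _ _) _.
  rewrite ler_pM2l//; apply: ler_sum => i _; apply: ler_sum => j _.
  by rewrite distrC (addrC `|a i j|).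
- by rewrite -[X in _ --> X]subr0; apply: cvgB => //; exact: cvg_cst.
- by rewrite -[X in _ --> X]addr0; apply: cvgD => //; exact: cvg_cst.
Qed.

Lemma continuous_dist_penalty (x0 : 'M[R]_(m, n)) (b zeta c : R) :
  continuous (fun x => Num.max (envelope x - b) zeta * expR (c * frob (x - x0))).
Proof.
move=> x; apply: (@cvgM _ _ (nbhs x)).
  apply: (@continuous_max _ _ (fun x => envelope x - b) (fun=> zeta)).
    apply: (@cvgB _ _ _ (nbhs x)); last exact: cvg_cst.
    exact: envelope_continuous.
  exact: cst_continuous.
apply: (@cvg_comp _ _ _ (fun x => c * frob (x - x0)) expR _ _ _ _
  (@continuous_expR _ _)).
apply: (@cvgM _ _ (nbhs x)); first exact: cvg_cst.
apply: (@cvg_comp _ _ _ (fun x => x - x0) (@frob R m n) _ _ _ _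
  (@frob_continuous _ _ _ (x - x0))).
by apply: (@cvgB _ _ _ (nbhs x)); [exact: cvg_id|exact: cvg_cst].
Qed.

(* Ekeland's argument for the logarithm of [envelope - b], which has slope at
   least [1 / C] outside of the sublevel set: were the bound to fail at [x0], a
   penalty [c * frob (x - x0)] with [c < 1 / C] would have a minimizer [x1] off the
   sublevel set, from which moving towards [q] still decreases the objective. *)
Lemma envelope_exponential_growth (b C zeta : R) (x0 : 'M[R]_(m, n)) :
  (forall x y (t : R), A x -> A y -> 0 <= t <= 1 -> A (x + t *: (y - x))) ->
  0 < C -> 0 < zeta ->
  (forall x, A x -> envelope x - b <= C * frob (gradient envelope x)) ->
  A x0 -> zeta <= envelope x0 - b ->
  zeta * expR (fdist x0 [set x | A x /\ envelope x - b < zeta] / C) <=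
    envelope x0 - b.
Proof.
set X := [set x | _] => A_convex C0 z0 slope Ax0 x0_out.
set D := fdist x0 X; set m0 := envelope x0 - b in x0_out *.
(* The first case includes an empty [X], for which [fdist] is the default value [0] of [inf]. *)
have [D0|D0] := leP D 0.
  apply: le_trans x0_out; rewrite ger_pMr// -expR0 ler_expR.
  by rewrite pmulr_lle0 ?invr_gt0.
rewrite leNgt; apply/negP => contra.
have m0_gt0 : 0 < m0 by exact: lt_le_trans x0_out.
(* The rate at which the exponential bound is an equality at [x0]; the negated goal places it below
   [C^-1]. *)
pose c0 := ln (m0 / zeta) / D.
have c0_ge0 : 0 <= c0.
  by rewrite divr_ge0 ?(ltW D0)// ln_ge0// ler_pdivlMr// mul1r.
have m0E : m0 = zeta * expR (c0 * D).
  rewrite /c0 divfK ?gt_eqF// lnK ?posrE ?divr_gt0// mulrC divfK// gt_eqF//.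
have c0_lt : c0 < C^-1.
  move: contra; rewrite m0E ltr_pM2l// ltr_expR mulrC.
  by rewrite ltr_pM2l.
(* [c0 < c] keeps the minimizer closer than [D] to [x0]; [c < C^-1] lets the descent outweigh the
   penalty. *)
pose c := (c0 + C^-1) / 2.
have c0c : c0 < c by rewrite /c; lra.
have cC : c < C^-1 by rewrite /c; lra.
have c_gt0 : 0 < c by exact: le_lt_trans c0c.
(* The maximum with [zeta] bounds [u] below by [zeta] times the exponential factor alone; on [A] it
   is inactive at distance less than [D] from [x0]. *)
pose u x := Num.max (envelope x - b) zeta * expR (c * frob (x - x0)).
have [x1 /set_mem Ax1 x1_min] : exists2 x1, x1 \in A &
    forall x, x \in A -> u x1 <= u x.
  apply: compact_EVT_min => //; apply: continuous_subspaceT.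
  exact: continuous_dist_penalty.
set r := frob (x1 - x0).
have u0 : u x0 = m0.
  rewrite /u subrr -(scale0r (0 : 'M[R]_(m, n))) frobZ normr0 mul0r.
  by rewrite mulr0 expR0 mulr1; apply/max_idPl.
have r_lt : r < D.
  have : zeta * expR (c * r) < zeta * expR (c * D).
    apply: (@le_lt_trans _ _ m0).
      rewrite -u0; apply: le_trans (x1_min _ _); last by rewrite inE.
      by rewrite ler_wpM2r ?expR_ge0// le_max lexx orbT.
    by rewrite m0E ltr_pM2l// ltr_expR ltr_pM2r.
  by rewrite ltr_pM2l// ltr_expR ltr_pM2l.
have ball_out x : A x -> frob (x - x0) < D -> zeta <= envelope x - b.
  move=> Ax xD; rewrite leNgt; apply/negP => xX.
  have : D <= frob (x0 - x) by exact: fdist_le.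
  by rewrite frob_distC leNgt xD.
have x1_out := ball_out _ Ax1 r_lt.
set m1 := envelope x1 - b in x1_out.
have [q Aq q_maj] := envelope_majorant x1.
set d := frob (x1 - q).
have m1_le : m1 * C^-1 <= 2 * l * d.
  rewrite ler_pdivrMr// mulrC; apply: le_trans (slope _ Ax1) _.
  rewrite ler_pM2l//; apply: le_trans (frob_le (gradient_coord_le q_maj)) _.
  by rewrite frobZ ger0_norm// mulr_ge0 ?ltW.
have m1_gt0 : 0 < m1 by exact: lt_le_trans x1_out.
have d_gt0 : 0 < d.
  have : 0 < 2 * l * d by apply: lt_le_trans m1_le; rewrite divr_gt0.
  by rewrite pmulr_rgt0// mulr_gt0.
have ld_gt0 : 0 < l * d by rewrite mulr_gt0.
(* Per unit length towards [q], the envelope falls to first order by at least [2 * (l * d)], while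
   the penalty costs at most [c * m1]. *)
have cm1 : c * m1 < 2 * (l * d).
  rewrite mulrA; apply: lt_le_trans m1_le.
  by rewrite mulrC ltr_pM2l.
(* The three bounds keep [y] in [A] by convexity, keep it closer than [D] to [x0], and make the
   second-order loss [t * (l * d)] at most half of the gap in [cm1]. *)
pose t := Num.min 1
  (Num.min ((D - r) / (2 * d)) ((2 * (l * d) - c * m1) / (2 * (l * d)))).
have t_gt0 : 0 < t.
  by rewrite !lt_min ltr01 !divr_gt0 ?mulr_gt0 ?subr_gt0.
have t_le1 : t <= 1 by rewrite ge_min lexx.
have td : t * (2 * d) <= D - r.
  by rewrite -ler_pdivlMr ?mulr_gt0// /t !ge_min lexx !orbT.
have tld : t * (2 * (l * d)) <= 2 * (l * d) - c * m1.
  by rewrite -ler_pdivlMr ?mulr_gt0// /t !ge_min lexx !orbT.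
pose y := x1 + t *: (q - x1).
have Ay : A y by apply: A_convex => //; rewrite (ltW t_gt0).
have yx0 : frob (y - x0) <= r + t * d.
  have -> : y - x0 = (x1 - x0) + t *: (q - x1) by rewrite /y addrAC.
  apply: le_trans (frob_triangle _ _) _.
  by rewrite frobZ gtr0_norm// (frob_distC q).
have y_out : zeta <= envelope y - b by apply: ball_out => //; nra.
have y_le : envelope y - b <= m1 - l * d ^+ 2 * (2 * t - t ^+ 2).
  have yq : y - q = (1 - t) *: (x1 - q).
    by apply/matrixP => i j; rewrite !mxE; ring.
  have := q_maj y; rewrite yq frobZ -/d exprMn real_normK ?num_real// /m1.
  nra.
have := x1_min y; rewrite inE => /(_ Ay).
rewrite /u -/m1 -/r (max_idPl x1_out) (max_idPl y_out) => u_le.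
have : m1 * expR (c * r) <= (m1 - l * d ^+ 2 * (2 * t - t ^+ 2)) *
    expR (c * t * d) * expR (c * r).
  apply: le_trans u_le _; rewrite -mulrA -expRD ler_pM ?expR_ge0//.
    exact: le_trans (ltW z0) y_out.
  by rewrite ler_expR -(mulrA c t) -mulrDr ler_pM2l// [leRHS]addrC.
rewrite ler_pM2r ?expR_gt0// -ler_pdivrMr ?expR_gt0// -expRN => m1_exp.
(* The bound [1 - z <= expR (- z)] linearizes the penalty; after division by [t * d] the inequality
   contradicts [tld]. *)
have : m1 * (1 - c * t * d) <= m1 - l * d ^+ 2 * (2 * t - t ^+ 2).
  by apply: le_trans m1_exp; rewrite ler_pM2l// expR_ge1Dx.
have td_gt0 : 0 < t * d by rewrite mulr_gt0.
have -> : m1 * (1 - c * t * d) = m1 - (c * m1) * (t * d) by ring.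
have -> : m1 - l * d ^+ 2 * (2 * t - t ^+ 2) =
  m1 - (2 * (l * d) - t * (l * d)) * (t * d) by ring.
rewrite lerD2l lerN2 ler_pM2r//; nra.
Qed.

End Envelope.

(** * Convexity and compactness of the set of policies *)

Section Policies.
Context {R : realType} {nS nA : nat}.
Implicit Types pi : 'M[R]_(nS, nA).

Lemma policies_ge0 pi s a : policies pi -> 0 <= pi s a.
Proof. by move=> /(_ s)[/(_ a)]; rewrite mxE. Qed.

Lemma policies_sum1 pi s : policies pi -> \sum_a pi s a = 1.
Proof. by move=> /(_ s)[_ <-]; apply: eq_bigr => a _; rewrite mxE. Qed.

Lemma policies_norm_le1 pi s a : policies pi -> `|pi s a| <= 1.
Proof.
move=> pol; rewrite ger0_norm ?policies_ge0// -(policies_sum1 s pol).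
rewrite (bigD1 a)//= lerDl sumr_ge0// => a' _; exact: policies_ge0.
Qed.

Lemma policies_convex pi pi' (t : R) : policies pi -> policies pi' ->
  0 <= t <= 1 -> policies (pi + t *: (pi' - pi)).
Proof.
move=> pol pol' /andP[t0 t1] s; split=> [a|].
  rewrite !mxE; have := policies_ge0 s a pol; have := policies_ge0 s a pol'; nra.
under eq_bigr do rewrite !mxE.
by rewrite big_split -mulr_sumr sumrB/= !policies_sum1// subrr mulr0 addr0.
Qed.

(** Policies form a closed subset of the unit cube, itself the image of a compact box of row vectors
    under the continuous [vec_mx]. *)
Lemma policies_compact : compact (@policies R nS nA).
Proof.
apply: (@subclosed_compact _ _
  [set pi : 'M[R]_(nS, nA) | forall s a, `[0, 1]%classic (pi s a)]).
- have -> : @policies R nS nA =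
      \bigcap_s ((\bigcap_a [set pi : 'M[R]_(nS, nA) | 0 <= pi s a]) `&`
        [set pi : 'M[R]_(nS, nA) | \sum_a pi s a = 1]).
    apply/seteqP; split=> [pi pol s _|pi pol s].
      split=> [a _|]; first exact: policies_ge0.
      exact: policies_sum1.
    have [pol0 pol1] := pol s I; split=> [a|]; first by rewrite mxE; exact: pol0.
    by rewrite -pol1; apply: eq_bigr => a _; rewrite mxE.
  apply: closed_bigI => s _; apply: closedI.
    apply: closed_bigI => a _.
    apply: (@preimage_closed _ _ (fun pi : 'M[R]_(nS, nA) => pi s a) [set r | 0 <= r]).
      by move=> pi _; exact: coord_continuous.
    exact: closed_ge.
  apply: (@preimage_closed _ _ (fun pi : 'M[R]_(nS, nA) => \sum_a pi s a)
      [set r | r = 1]).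
    move=> pi _; apply: continuous_big => [|a _]; first exact: add_continuous.
    exact: coord_continuous.
  exact: closed_eq.
- have -> : [set pi : 'M[R]_(nS, nA) | forall s a, `[0, 1]%classic (pi s a)] =
      vec_mx @` [set v : 'rV[R]_(nS * nA) | forall k, `[0, 1]%classic (v 0 k)].
    apply/seteqP; split=> [pi pol|_ [v v01 <-] s a]; last by rewrite mxE.
    exists (mxvec pi); last exact: mxvecK.
    by move=> k; case/mxvec_indexP: k => s a; rewrite mxvecE.
  apply: continuous_compact; last first.
    by apply: (@rV_compact R _ (fun=> `[0, 1]%classic)) => k; exact: segment_compact.
  apply: continuous_subspaceT => v; move=> U /nbhs_ballP[e e0 eU].
  apply/nbhs_ballP; exists e => // w vw; apply: eU; split=> // s a.
  by rewrite !mxE; exact: vw.2.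
- by move=> pi pol s a /=; rewrite in_itv/= policies_ge0// ler_normlW// policies_norm_le1.
Qed.

End Policies.

(** * Signs of the worst-case objective and of the constants *)

Section WorstCaseObjective.
Context {R : realType} {nS nA : nat}.
Variable M : rmdp R nS nA.

Let discount_gt0 : 0 < discount M.
Proof. by have /andP[] := discount_itv M. Qed.

Lemma value_ge0 pi p s : policies pi -> kernels p -> 0 <= value M pi p s.
Proof.
move=> pol ker; rewrite /value; set u := (X in limn X).
(* A divergent sequence has the default limit [0]. *)
have [cu|/dvgP ->] := pselect (cvgn u); last by [].
apply: limr_ge => //; apply: nearW => T; rewrite /u.
apply: sumr_ge0 => x _; apply: sumr_ge0 => a _; apply: mulr_ge0.
  rewrite /traj_prob mulr_ge0// prodr_ge0// => t _.
  rewrite mulr_ge0 ?(policies_ge0 _ _ pol)//.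
  by have [] := ker (src x t) (a t).
apply: sumr_ge0 => t _; rewrite mulr_ge0 ?exprn_ge0 ?(ltW discount_gt0)//.
by have /andP[] := cost_itv M (src x t) (a t) (tgt x t).
Qed.

(* Junk value: [sup] is [0] on sets that are not bounded above. *)
Lemma phi_ge0 pi : policies pi -> 0 <= phi M pi.
Proof.
move=> pol; rewrite /phi; set E := (X in sup X).
have E_ge0 r : E r -> 0 <= r.
  move=> [p Mp <-]; apply: sumr_ge0 => s _; rewrite mulr_ge0//.
    by have [] := init_simplex M.
  exact: value_ge0 (ambig_kernels Mp).
have [Esup|/sup_out -> //] := pselect (has_sup E).
have [[r Er] Eub] := Esup.
exact: le_trans (E_ge0 _ Er) (ub_le_sup Eub Er).
Qed.

Lemma ell_pi_gt0 : 0 < ell_pi M.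
Proof.
have /andP[_ g1] := discount_itv M.
by rewrite divr_gt0 ?exprn_gt0 ?subr_gt0// !mulr_gt0// ltr0n (actions_gt0 M).
Qed.

(** Strictness comes from the term [L_pi M / (2 * ell_pi M)], as there is at least one action. *)
Lemma C_ell_gt0 : 0 < C_ell M.
Proof.
have /andP[_ g1] := discount_itv M.
have D_ge0 : 0 <= fine (D_mismatch M).
  rewrite /D_mismatch; set E := [set _ | _ in _ & _ in _].
  (* The supremum of the empty set is [-oo], which [fine] sends to [0]. *)
  have [->|/set0P[x Ex]] := eqVneq E set0; first by rewrite ereal_sup0.
  apply/fine_ge0/(le_trans _ (ereal_sup_ubound Ex)).
  by case: Ex => pi _ [p _ <-]; exact: bigmax_ge_id.
rewrite ltr_wpDl//.
  by rewrite divr_ge0 ?mulr_ge0 ?sqrtr_ge0// subr_ge0 ltW.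
have L_gt0 : 0 < L_pi M.
  by rewrite divr_gt0 ?exprn_gt0 ?subr_gt0// sqrtr_gt0 ltr0n (actions_gt0 M).
by apply: divr_gt0 => //; rewrite mulr_gt0 ?ell_pi_gt0.
Qed.

End WorstCaseObjective.

Theorem lemma4p2 (R : realType) (nS nA : nat) (M : rmdp R nS nA) (zeta : R)
    (D_finite : (D_mismatch M < +oo)%E)
    (known_fact : forall pi : 'M[R]_(nS, nA), policies pi ->
       moreau M pi <= phi M pi /\
       phi M pi <= C_ell M * frob (gradient (moreau M) pi) + phi_min M)
    (zeta_gt0 : 0 < zeta)
    (pi : 'M[R]_(nS, nA)) (pi_out : (policies `\` near_opt M zeta) pi) :
  phi M pi - phi_min M >=
    zeta * expR (fdist pi (near_opt M zeta) / C_ell M).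
Proof.
have [pol pi_far] := pi_out.
have pi_ge : zeta <= moreau M pi - phi_min M.
  by rewrite leNgt; apply/negP => pi_lt; exact: pi_far.
(* The growth bound already holds for the envelope, which lies below [phi M] on policies. *)
apply: (@le_trans _ _ (moreau M pi - phi_min M)); last first.
  by rewrite lerD2r; have [] := known_fact _ pol.
apply: (envelope_exponential_growth (ell_pi_gt0 M) (@phi_ge0 _ _ _ M)) => //.
- by exists pi.
- exact: policies_compact.
- by move=> *; exact: policies_norm_le1.
- by move=> *; exact: policies_convex.
- exact: C_ell_gt0.
(* The slope condition chains both halves of [known_fact] through [phi M x]. *)
- move=> x polx; rewrite lerBlDr; have [moreau_le] := known_fact _ polx.
  exact: le_trans.
Qed.
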